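(* Suppose the regularity conditions (R), the terminal conditions (T), the open-loop stability condition (S) and the simplifying conditions (E) stated in the context hold. Then for any initial condition $x_0\in\mathbb{X}_N$, any weight $\lambda>0$, any disturbances $w(k)\in\mathbb{R}^n$, $k\in\mathbb{I}_{\ge0}$, and any time $T\in\mathbb{I}_{\ge0}$, the closed-loop system $x(k+1)=f(x(k),u(k))+w(k)$, $u(k)=\pi_{\mathrm{slack}}(x(k))$, $x(0)=x_0$, satisfies $$\frac{1}{1+\epsilon_\lambda}\sum_{k=0}^{T-1}\ell(x(k),u(k))\le V_{\mathrm{nom}}(x_0)+\lambda c_{\delta,4}\sum_{k=0}^{T-1}\|w(k)\|^2,\qquad \epsilon_\lambda:=\frac{1}{\lambda}\frac{\sigma_{\max}(Q)}{c_{\delta,3}}\in(0,\infty).$$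
   Context: Notation. $\|\cdot\|$ is the Euclidean norm; for a positive definite matrix $Q$, $\|x\|_Q=\sqrt{x^\top Qx}$, and $\sigma_{\max}(Q)$ is the maximal eigenvalue of the symmetric matrix $Q$. $\mathbb{I}_{[a,b]}$ (resp. $\mathbb{I}_{\ge a}$) is the set of integers in $[a,b]$ (resp. $\ge a$). $\mathcal{K}_\infty$: continuous, strictly increasing, radially unbounded functions $\alpha:\mathbb{R}_{\ge0}\to\mathbb{R}_{\ge0}$ with $\alpha(0)=0$. System. $x(k+1)=f(x(k),u(k))+w(k)$, $x(0)=x_0\in\mathbb{R}^n$, with inputs $u(k)\in\mathbb{U}\subseteq\mathbb{R}^m$ and arbitrary disturbances $w(k)\in\mathbb{R}^n$. $\ell:\mathbb{R}^n\times\mathbb{U}\to\mathbb{R}_{\ge0}$ is a stage cost and $\mathbb{X}\subseteq\mathbb{R}^n$ is a closed state constraint set. (R) Regularity: there is $\alpha_\ell\in\mathcal{K}_\infty$ with $\ell(x,u)\ge\alpha_\ell(\|x\|+\|u\|)$ for all $(x,u)\in\mathbb{R}^n\times\mathbb{U}$; $f(0,0)=0$, $\ell(0,0)=0$, $0\in\mathrm{int}(\mathbb{U})$, $0\in\mathrm{int}(\mathbb{X})$; $f,\ell$ are continuous; $\mathbb{U}$ is compact. Nominal MPC. Fix $N\in\mathbb{I}_{\ge1}$. For $x\in\mathbb{R}^n$ and $\mathbf{u}=(\mathbf{u}_0,\dots,\mathbf{u}_{N-1})\in\mathbb{U}^N$, $x_{\mathbf{u}}(k,x)$ is the state after $k$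 steps of the undisturbed system ($w\equiv0$) started at $x_{\mathbf{u}}(0,x)=x$. Let $V_{\mathrm{f}}:\mathbb{R}^n\to\mathbb{R}_{\ge0}$ be continuous, $\mathbb{X}_{\mathrm{f}}\subseteq\mathbb{X}$ closed, and $$\mathcal{J}_N(x,\mathbf{u})=\sum_{k=0}^{N-1}\ell(x_{\mathbf{u}}(k,x),\mathbf{u}_k)+V_{\mathrm{f}}(x_{\mathbf{u}}(N,x)).$$ $V_{\mathrm{nom}}(x)$ is the minimum of $\mathcal{J}_N(x,\mathbf{u})$ over $\mathbf{u}\in\mathbb{U}^N$ subject to $x_{\mathbf{u}}(k,x)\in\mathbb{X}$, $k\in\mathbb{I}_{[0,N-1]}$, and $x_{\mathbf{u}}(N,x)\in\mathbb{X}_{\mathrm{f}}$; $\mathbb{X}_N\subseteq\mathbb{X}$ is the set of $x$ for which these constraints are feasible. (T) Terminal conditions: there are $k_{\mathrm{f}}:\mathbb{X}_{\mathrm{f}}\to\mathbb{U}$ and $\alpha_{\mathrm{f}}\in\mathcal{K}_\infty$ such that for every $x\in\mathbb{X}_{\mathrm{f}}$, with $u=k_{\mathrm{f}}(x)$, $x^+=f(x,u)$: $V_{\mathrm{f}}(x^+)\le V_{\mathrm{f}}(x)-\ell(x,u)$; $(x,u)\in\mathbb{X}\times\mathbb{U}$; $x^+\in\mathbb{X}_{\mathrm{f}}$; $V_{\mathrm{f}}(x)\le\alpha_{\mathrm{f}}(\|x\|)$. Moreover $0\in\mathrm{int}(\mathbb{X}_{\mathrm{f}})$ and $\mathbb{X}_N$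 is compact. (S) Open-loop stability: $V_\delta:\mathbb{R}^n\times\mathbb{R}^n\to\mathbb{R}_{\ge0}$ is continuous and there are $\alpha_{\delta,1},\dots,\alpha_{\delta,4}\in\mathcal{K}_\infty$ such that for all $x,z,w\in\mathbb{R}^n$, $u\in\mathbb{U}$: $\alpha_{\delta,1}(\|x-z\|)\le V_\delta(x,z)\le\alpha_{\delta,2}(\|x-z\|)$ and $V_\delta(f(x,u)+w,f(z,u))-V_\delta(x,z)\le-\alpha_{\delta,3}(\|x-z\|)+\alpha_{\delta,4}(\|w\|)$. (E) Simplifying conditions: $\ell(x,u)=\|x\|_Q^2+\|u\|_R^2$ with positive definite matrices $Q,R$; and $\alpha_{\delta,i}(r)=c_{\delta,i}r^2$ are quadratic, $i\in\mathbb{I}_{[1,4]}$. Relaxed MPC. For a weight $\lambda>0$, $$V_{\mathrm{slack}}(x)=\min_{\bar{x}\in\mathbb{R}^n,\,\mathbf{u}\in\mathbb{U}^N}\mathcal{J}_N(\bar{x},\mathbf{u})+\lambda V_\delta(x,\bar{x})\quad\text{s.t. }x_{\mathbf{u}}(k,\bar{x})\in\mathbb{X},\ k\in\mathbb{I}_{[0,N-1]},\ x_{\mathbf{u}}(N,\bar{x})\in\mathbb{X}_{\mathrm{f}},$$ with minimizer denoted $(\bar{x}^*_{\mathrm{slack}}(x),\mathbf{u}^*_{\mathrm{slack}}(x))$, and $\pi_{\mathrm{slack}}(x)=\mathbf{u}^*_{\mathrm{slack},0}(x)\in\mathbb{U}$ is its first input. *)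

(* Defs.v *)
(* MathComp-Analysis *)
From HB Require Import structures.
From mathcomp Require Import all_boot all_order all_algebra.
From mathcomp Require Import all_classical all_reals all_analysis.

Set Implicit Arguments.
Unset Strict Implicit.
Unset Printing Implicit Defensive.

Import Order.TTheory GRing.Theory Num.Theory.
Import numFieldNormedType.Exports.

Local Open Scope classical_set_scope.
Local Open Scope ring_scope.

Section Basics.
Context {R : realType}.

(* Minimal and maximal elements of a set of reals; the value 0 is returned when
   the minimum (maximum) is not attained. *)
Definition minimum (A : set R) : R := xget 0 (A `&` lbound A).
Definition maximum (A : set R) : R := xget 0 (A `&` ubound A).

(* The library norm on matrices is the max norm, hence the explicit Euclidean
   norm; both induce the same topology. *)
Definition enorm n (x : 'cV[R]_n) : R := Num.sqrt (\sum_i x i ord0 ^+ 2).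

Definition posdef n (Q : 'M[R]_n) : Prop :=
  Q^T = Q /\ forall x : 'cV[R]_n, x != 0 -> 0 < (x^T *m Q *m x) ord0 ord0.

Definition wnorm n (Q : 'M[R]_n) (x : 'cV[R]_n) : R :=
  Num.sqrt ((x^T *m Q *m x) ord0 ord0).

Definition sigma_max n (Q : 'M[R]_n) : R :=
  maximum [set a | eigenvalue Q a].

(* Comparison functions are total functions on R of which only the restriction
   to the nonnegative reals matters. *)
Definition class_Kinfty (a : R -> R) : Prop :=
  [/\ {within `[0, +oo[, continuous a},
      (forall r s, 0 <= r -> r < s -> a r < a s),
      a r @[r --> +oo] --> +oo
    & a 0 = 0].

End Basics.

Section MPC.
Context {R : realType} {n m : nat}.
Implicit Types (x z w : 'cV[R]_n) (u : 'cV[R]_m).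

(* The dynamics, the stage cost and the terminal control law are total
   functions; they are only constrained on R^n x U (resp. on Xf). *)
Variables (f : 'cV[R]_n -> 'cV[R]_m -> 'cV[R]_n).
Variables (l : 'cV[R]_n -> 'cV[R]_m -> R).
Variables (U : set 'cV[R]_m) (X Xf : set 'cV[R]_n).
Variables (Vf : 'cV[R]_n -> R) (Vd : 'cV[R]_n -> 'cV[R]_n -> R).

Definition regular : Prop :=
  (exists2 al : R -> R, class_Kinfty al &
     forall x u, U u -> al (enorm x + enorm u) <= l x u) /\
  [/\ f 0 0 = 0, l 0 0 = 0, U° 0 & X° 0] /\
  [/\ {within [set p | U p.2], continuous (fun p => f p.1 p.2)},
      {within [set p | U p.2], continuous (fun p => l p.1 p.2)}
    & compact U].

Definition open_loop_stable (a1 a2 a3 a4 : R -> R) : Prop :=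
  (forall x z, 0 <= Vd x z) /\
  continuous (fun p : 'cV[R]_n * 'cV[R]_n => Vd p.1 p.2) /\
  [/\ class_Kinfty a1, class_Kinfty a2, class_Kinfty a3 & class_Kinfty a4] /\
  forall x z w u, U u ->
    a1 (enorm (x - z)) <= Vd x z <= a2 (enorm (x - z)) /\
    Vd (f x u + w) (f z u) - Vd x z <= - a3 (enorm (x - z)) + a4 (enorm w).

Section Horizon.
Context {N : nat}.
Implicit Types (us : N.-tuple 'cV[R]_m).

(* The state after k <= N steps of the undisturbed system, started at x and
   driven by the first k inputs of us. *)
Definition traj us (k : nat) x : 'cV[R]_n := foldl f x (take k us).

Definition feasible x us : Prop :=
  [/\ (forall i, U (tnth us i)),
      (forall k, (k < N)%N -> X (traj us k x))
    & Xf (traj us N x)].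

Definition cost x us : R :=
  \sum_(k < N) l (traj us k x) (tnth us k) + Vf (traj us N x).

Definition slack_cost (lambda : R) x (p : 'cV[R]_n * N.-tuple 'cV[R]_m) : R :=
  cost p.1 p.2 + lambda * Vd x p.1.

Definition slack_minimizers (lambda : R) x :
    set ('cV[R]_n * N.-tuple 'cV[R]_m) :=
  [set p | feasible p.1 p.2 /\
     forall q, feasible q.1 q.2 ->
       slack_cost lambda x p <= slack_cost lambda x q].

End Horizon.

Definition feasible_states (N : nat) : set 'cV[R]_n :=
  [set x | exists us : N.-tuple 'cV[R]_m, feasible x us].

Definition V_nom (N : nat) x : R :=
  minimum [set cost x us | us in [set us : N.-tuple 'cV[R]_m | feasible x us]].

Definition terminal (N : nat) : Prop :=
  (exists (kf : 'cV[R]_n -> 'cV[R]_m) (af : R -> R), class_Kinfty af /\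
     forall x, Xf x ->
       [/\ Vf (f x (kf x)) <= Vf x - l x (kf x),
           X x /\ U (kf x),
           Xf (f x (kf x))
         & Vf x <= af (enorm x)]) /\
  Xf° 0 /\ compact (feasible_states N).

End MPC.

(* Main.v *)
Require Import Defs.
From HB Require Import structures.
From mathcomp Require Import all_boot all_order all_algebra.
From mathcomp Require Import all_classical all_reals all_analysis.
From mathcomp Require Import ring lra.

Import Order.TTheory GRing.Theory Num.Theory.
Import numFieldNormedType.Exports.

Local Open Scope classical_set_scope.
Local Open Scope ring_scope.

(** Let [V y] be the optimal value of the relaxed problem at the measured state
    [y], attained at an initial state [z] and inputs [us]. Restarting from
    [f z us_0] with the inputs shifted by one step and completed by the terminal
    controller is feasible for the relaxed problem at the next measured state,
    whatever the disturbance: the constraints involve [z] only, never the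
    measured state. By the terminal condition this candidate lowers the nominal
    cost by [l z us_0] ([cost_decrease]), and by open-loop stability it lowers
    the penalty [lambda * Vd y z] by [lambda * c3 * |y - z|^2], up to
    [lambda * c4 * |w|^2]; see [slack_cost_decrease].

    The cost actually paid is [l y us_0], at the measured state rather than at
    [z]. Young's inequality for the quadratic form [Q] gives
    [l y us_0 <= (1 + eps) (l z us_0 + sigma_max Q / eps * |y - z|^2)]
    ([stage_cost_young]), and [eps] is the value for which
    [sigma_max Q / eps = lambda * c3]. Hence [(1 + eps)^-1 * l] is dominated by
    the decrease of [V] plus the disturbance term, and the claim follows by
    telescoping: [V >= 0] at the end, and [V x0 <= V_nom x0] at the start because
    the choice [z = x0] has no penalty.

    Two facts have to hold for this to make sense. The minima defining [V] and
    [V_nom] are attained: feasible pairs form a closed subset of the product of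
    the compact set of feasible states and the compact set of input sequences
    ([feasible_compact]), on which the costs are continuous. And [sigma_max Q] is
    an eigenvalue that bounds the Rayleigh quotient ([sigma_maxP]). *)

(** * Minima and maxima *)

Lemma minimum_mem (R : realType) (A : set R) :
  A `&` lbound A !=set0 -> A (minimum A).
Proof. by case=> a Aa; rewrite /minimum; case: xgetP => [? _ []|/(_ a)]. Qed.

Lemma maximum_eq (R : realType) (A : set R) (a : R) :
  A a -> ubound A a -> maximum A = a.
Proof.
move=> Aa uAa; rewrite /maximum; case: xgetP => [b _ [Ab uAb]|/(_ a) []] //.
by apply/eqP; rewrite eq_le uAa // uAb.
Qed.

(** * Quadratic forms and the largest eigenvalue *)

Definition qform {R : realType} {n} (Q : 'M[R]_n) (x : 'cV[R]_n) : R :=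
  (x^T *m Q *m x) ord0 ord0.

Section QuadraticForms.
Context {R : realType} {n : nat}.
Implicit Types (Q : 'M[R]_n) (x y : 'cV[R]_n).

Lemma qformE Q x : qform Q x = \sum_j (\sum_k x k ord0 * Q k j) * x j ord0.
Proof.
rewrite /qform mxE; apply: eq_bigr => j _; rewrite mxE; congr (_ * _).
by apply: eq_bigr => k _; rewrite mxE.
Qed.

Lemma qform0 Q : qform Q 0 = 0.
Proof. by rewrite /qform mulmx0 mxE. Qed.

Lemma qformZ Q a x : qform Q (a *: x) = a ^+ 2 * qform Q x.
Proof.
have trZ : (a *: x)^T = a *: x^T by rewrite linearZ.
by rewrite /qform trZ -!scalemxAl -scalemxAr scalerA mxE expr2.
Qed.

Lemma qform_comb Q a b x y : Q^T = Q ->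
  qform Q (a *: x + b *: y) =
  a ^+ 2 * qform Q x + 2 * a * b * (x^T *m Q *m y) ord0 ord0
  + b ^+ 2 * qform Q y.
Proof.
move=> symQ.
have sym : (y^T *m Q *m x) ord0 ord0 = (x^T *m Q *m y) ord0 ord0.
  have -> : x^T *m Q *m y = (y^T *m Q *m x)^T.
    by rewrite !trmx_mul trmxK symQ mulmxA.
  by rewrite [RHS]mxE.
have trD : (a *: x + b *: y)^T = a *: x^T + b *: y^T.
  by rewrite linearD /= !linearZ.
rewrite /qform trD !mulmxDl !mulmxDr.
rewrite -!scalemxAl -!scalemxAr.
move: sym; move: (_ *m _ *m y) (_ *m _ *m x) (x^T *m _ *m y) (_ *m Q *m x).
by move=> A B C D sym; rewrite !mxE sym; ring.
Qed.

Lemma qform_id x : qform 1%:M x = enorm x ^+ 2.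
Proof.
rewrite /enorm sqr_sqrtr; last by apply: sumr_ge0 => i _; exact: sqr_ge0.
by rewrite /qform mulmx1 mxE; apply: eq_bigr => i _; rewrite mxE expr2.
Qed.

Lemma qform_ge0 {Q} x : posdef Q -> 0 <= qform Q x.
Proof.
case=> _ posQ; have [->|x0] := eqVneq x 0; first by rewrite qform0.
exact/ltW/posQ.
Qed.

Lemma enorm0 : enorm (0 : 'cV[R]_n) = 0.
Proof. by rewrite /enorm big1 ?sqrtr0 // => i _; rewrite mxE expr0n. Qed.

Lemma enorm_ge0 x : 0 <= enorm x.
Proof. exact: sqrtr_ge0. Qed.

Lemma enorm_eq0 x : enorm x = 0 -> x = 0.
Proof.
move=> /(congr1 (fun r => r ^+ 2)); rewrite /enorm sqr_sqrtr; last first.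
  by apply: sumr_ge0 => i _; exact: sqr_ge0.
rewrite expr0n /= => /psumr_eq0P H; apply/colP => i; rewrite mxE.
by apply/eqP; rewrite -sqrf_eq0 H // => j _; exact: sqr_ge0.
Qed.

Lemma wnorm_sqr Q x : posdef Q -> wnorm Q x ^+ 2 = qform Q x.
Proof. by move=> pQ; rewrite /wnorm sqr_sqrtr //; exact: qform_ge0. Qed.

(** Along the direction [y = Q x] the form grows linearly in the step with slope
    [2 |y|^2]; positive semidefiniteness forbids this unless [y = 0]. *)
Lemma psd_isotropic_kernel Q x : Q^T = Q -> (forall y, 0 <= qform Q y) ->
  qform Q x = 0 -> x^T *m Q = 0.
Proof.
move=> symQ psdQ Qx0; set y : 'cV_n := (x^T *m Q)^T.
suff y0 : enorm y = 0 by rewrite -(trmxK (x^T *m Q)) -/y (enorm_eq0 y y0) trmx0.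
have xQy : (x^T *m Q *m y) ord0 ord0 = enorm y ^+ 2.
  by rewrite -qform_id /qform mulmx1 /y trmxK.
apply/eqP; rewrite eq_le enorm_ge0 andbT leNgt; apply/negP => ygt0.
have s0 : 0 < enorm y ^+ 2 by rewrite exprn_gt0.
have q0 := psdQ y.
(* A negative step short enough for the linear term to dominate the quadratic
   one; the 1 in the denominator covers the case where the form vanishes at y. *)
have := psdQ (1 *: x + - (enorm y ^+ 2 / (1 + qform Q y)) *: y).
rewrite qform_comb // Qx0 xQy; set s := enorm y ^+ 2 in s0 *.
set q := qform Q y in q0 *.
have -> : 1 ^+ 2 * 0 + 2 * 1 * - (s / (1 + q)) * s + (- (s / (1 + q))) ^+ 2 * q
  = - (s ^+ 2 * (2 + q) / (1 + q) ^+ 2).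
  by field; rewrite gt_eqF //; lra.
rewrite oppr_ge0 leNgt divr_gt0 // ?exprn_gt0 ?mulr_gt0 ?exprn_gt0 //; lra.
Qed.

(** The difference of the two sides is [e^-1] times the form at
    [e *: z - (x - z)]. *)
Lemma qform_young Q (e : R) x z : posdef Q -> 0 < e ->
  qform Q x <= (1 + e) * (qform Q z + e^-1 * qform Q (x - z)).
Proof.
move=> pQ e0; have symQ := pQ.1.
have -> : qform Q x = qform Q (1 *: z + 1 *: (x - z)).
  by rewrite !scale1r addrC subrK.
have := qform_ge0 (e *: z + (- 1) *: (x - z)) pQ.
rewrite !qform_comb //.
move: (_ ord0 ord0) (qform Q z) (qform Q (x - z)) => b a c H.
rewrite -subr_ge0.
have -> : (1 + e) * (a + e^-1 * c) - (1 ^+ 2 * a + 2 * 1 * 1 * b + 1 ^+ 2 * c)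
  = e^-1 * (e ^+ 2 * a + 2 * e * -1 * b + (-1) ^+ 2 * c).
  by field; rewrite gt_eqF.
by rewrite mulr_ge0 // invr_ge0 ltW.
Qed.

(** Row vectors, because the eigenvectors of a matrix act on its left. *)
Lemma qform_continuous Q : continuous (fun v : 'rV[R]_n => qform Q v^T).
Proof.
have -> : (fun v : 'rV[R]_n => qform Q v^T)
  = (fun v => \sum_j (\sum_k v ord0 k * Q k j) * v ord0 j).
  apply/funext => v; rewrite qformE; apply: eq_bigr => j _; rewrite mxE.
  by congr (_ * _); apply: eq_bigr => k _; rewrite mxE.
apply: continuous_big => [|j _]; first exact: add_continuous.
move=> v; apply: continuousM; last exact: coord_continuous.
move: v; apply: continuous_big => [|k _]; first exact: add_continuous.
move=> v; apply: continuousM; first exact: coord_continuous.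
exact: cst_continuous.
Qed.

Lemma sphere_compact : compact [set v : 'rV[R]_n | qform 1%:M v^T = 1].
Proof.
apply: (@subclosed_compact _ _
  [set v : 'rV[R]_n | forall i, `[-1, 1]%classic (v ord0 i)]).
- rewrite (_ : mkset _ = (fun v : 'rV[R]_n => qform 1%:M v^T) @^-1` [set 1]) //.
  apply: preimage_closed; last exact: closed_eq.
  by move=> v _; exact: qform_continuous.
- pose box : 'I_n -> set R := fun=> `[-1, 1]%classic.
  have := @rV_compact _ _ box; apply=> i; exact: segment_compact.
move=> v /= v1 i; rewrite in_itv /= -ler_norml -(@ler_pXn2r _ 2) ?nnegrE //.
rewrite expr1n -v1 qform_id sqr_sqrtr; last first.
  by apply: sumr_ge0 => j _; exact: sqr_ge0.
rewrite (bigD1 i) //= !mxE real_normK ?num_real // lerDl.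
by apply: sumr_ge0 => j _; exact: sqr_ge0.
Qed.

(** The maximum [M] of the form on the unit sphere is attained, by compactness.
    At a maximizer [v] the semidefinite form [M - Q] vanishes, so [v] is in its
    kernel, i.e. [v] is an eigenvector for [M]. Every other eigenvalue is a value
    of the Rayleigh quotient, hence at most [M]. *)
Lemma sigma_maxP Q : (0 < n)%N -> Q^T = Q ->
  eigenvalue Q (sigma_max Q) /\
  forall x, qform Q x <= sigma_max Q * enorm x ^+ 2.
Proof.
move=> n0 symQ.
have normalized x : x != 0 -> qform 1%:M ((enorm x)^-1 *: x) = 1.
  move=> x0; rewrite qformZ qform_id exprVn mulVf // sqrf_eq0.
  by apply: contra x0 => /eqP/enorm_eq0 ->.
have [v vS vmax] : exists2 v : 'rV[R]_n, qform 1%:M v^T = 1 &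
    forall y : 'rV[R]_n, qform 1%:M y^T = 1 -> qform Q y^T <= qform Q v^T.
  have [] := @compact_EVT_max _ R (fun v : 'rV[R]_n => qform Q v^T) _ _
    sphere_compact.
  - exists ((enorm (const_mx 1 : 'cV[R]_n))^-1 *: const_mx 1)^T.
    rewrite /= trmxK normalized //; apply/eqP => /colP /(_ (Ordinal n0)).
    by rewrite !mxE => /eqP; rewrite oner_eq0.
  - exact/continuous_subspaceT/qform_continuous.
  move=> v; rewrite inE => vS H; exists v => // y yS; apply: H.
  by rewrite inE.
pose M := qform Q v^T.
have rayleigh x : qform Q x <= M * enorm x ^+ 2.
  have [->|x0] := eqVneq x 0; first by rewrite qform0 enorm0 expr0n mulr0.
  have ex : 0 < enorm x.
    rewrite lt_neqAle enorm_ge0 andbT eq_sym.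
    by apply: contra x0 => /eqP/enorm_eq0 ->.
  have := vmax ((enorm x)^-1 *: x)^T; rewrite trmxK normalized // => /(_ erefl).
  by rewrite qformZ exprVn ler_pdivrMl ?exprn_gt0 // mulrC.
have v0 : v != 0.
  apply/eqP => v0; move: vS; rewrite v0 trmx0 qform0.
  by move=> /esym/eqP; rewrite oner_eq0.
have eigM : eigenvalue Q M.
  apply/eigenvalueP; exists v => //.
  have qB x : qform (M%:M - Q) x = M * enorm x ^+ 2 - qform Q x.
    rewrite -qform_id /qform mulmx1 mulmxBr mulmxBl mul_mx_scalar -scalemxAl.
    by move: (x^T *m x) (_ *m Q *m x) => A B; rewrite !mxE.
  have /eqP : v^T^T *m (M%:M - Q) = 0.
    apply: psd_isotropic_kernel.
    - by rewrite linearB /= tr_scalar_mx symQ.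
    - by move=> y; rewrite qB subr_ge0; exact: rayleigh.
    - by rewrite qB -qform_id vS mulr1 subrr.
  by rewrite trmxK mulmxBr subr_eq0 mul_mx_scalar => /eqP <-.
have -> : sigma_max Q = M; last by [].
apply: maximum_eq => // a /eigenvalueP [y yQ y0].
have ey : 0 < enorm y^T ^+ 2.
  rewrite exprn_gt0 // lt_neqAle enorm_ge0 andbT eq_sym; apply: contra y0.
  by move=> /eqP/enorm_eq0/(congr1 trmx); rewrite trmxK trmx0 => ->.
rewrite -(ler_pM2r ey); apply: le_trans (rayleigh y^T).
by rewrite -qform_id /qform trmxK mulmx1 yQ -scalemxAl [X in _ <= X]mxE.
Qed.

Lemma sigma_max_gt0 Q : (0 < n)%N -> posdef Q -> 0 < sigma_max Q.
Proof.
move=> n0 [symQ posQ]; have [/eigenvalueP [v vQ v0] _] := sigma_maxP Q n0 symQ.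
have vT0 : v^T != 0 by rewrite -(inj_eq trmx_inj) trmxK trmx0.
have := posQ _ vT0.
rewrite trmxK vQ -scalemxAl mxE pmulr_lgt0 // lt_neqAle.
have -> : (v *m v^T) ord0 ord0 = enorm v^T ^+ 2.
  by rewrite -qform_id /qform trmxK mulmx1.
rewrite sqr_ge0 andbT eq_sym sqrf_eq0.
by apply: contra vT0 => /eqP/enorm_eq0 ->.
Qed.

End QuadraticForms.

(** Only the state differs between the two stage costs, so Young's inequality is
    applied to [Q] alone; the Rayleigh bound then replaces the weighted distance
    by the Euclidean one. *)
Lemma stage_cost_young (R : realType) (n m : nat) (Q : 'M[R]_n) (Ru : 'M[R]_m)
    (e : R) x z u :
  (0 < n)%N -> posdef Q -> posdef Ru -> 0 < e ->
  qform Q x + qform Ru u <=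
  (1 + e) * (qform Q z + qform Ru u + sigma_max Q / e * enorm (x - z) ^+ 2).
Proof.
move=> n0 pQ pR e0; have [_ rayleigh] := sigma_maxP Q n0 pQ.1.
have e1 : 0 < 1 + e by lra.
apply: (@le_trans _ _
  ((1 + e) * (qform Q z + e^-1 * qform Q (x - z)) + (1 + e) * qform Ru u)).
  apply: lerD; first exact: qform_young.
  by rewrite ler_peMl ?qform_ge0 //; lra.
rewrite -mulrDr ler_pM2l // addrAC lerD2l -mulrA mulrCA ler_pM2l ?invr_gt0 //.
Qed.
(** * Continuity along trajectories and existence of minimizers *)

Lemma rV_coord_continuous (T : topologicalType) k (i : 'I_k) :
  continuous (fun v : 'rV[T]_k => v ord0 i).
Proof.
move=> v W Wv; exists (fun _ j => if j == i then W else setT).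
  move=> i' j; case: eqP => [->|_]; last exact: filterT.
  by rewrite ord1.
by move=> v' /(_ ord0 i); rewrite eqxx.
Qed.

Lemma within_continuous_comp (S T V : topologicalType) (A : set S) (B : set T)
    (g : S -> T) (h : T -> V) :
  {within A, continuous g} -> (forall x, A x -> B (g x)) ->
  {within B, continuous h} -> {within A, continuous (fun x => h (g x))}.
Proof.
move=> /subspace_continuousP gc gAB /subspace_continuousP hc.
apply/subspace_continuousP => x Ax W Wx.
have := gc x Ax _ (hc (g x) (gAB x Ax) W Wx); rewrite /within /=.
by apply: (@filterS _ (nbhs x)) => y /= H Ay; exact: H Ay (gAB y Ay).
Qed.

Lemma within_continuous_pair (S T V : topologicalType) (A : set S)
    (g : S -> T) (h : S -> V) :
  {within A, continuous g} -> {within A, continuous h} ->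
  {within A, continuous (fun x => (g x, h x))}.
Proof.
move=> /subspace_continuousP gc /subspace_continuousP hc.
by apply/subspace_continuousP => x Ax; exact: cvg_pair (gc x Ax) (hc x Ax).
Qed.

Section Minimizers.
Context {R : realType} {n m N : nat}.
Variables (f : 'cV[R]_n -> 'cV[R]_m -> 'cV[R]_n).
Variables (l : 'cV[R]_n -> 'cV[R]_m -> R).
Variables (U : set 'cV[R]_m) (X Xf : set 'cV[R]_n).
Variables (Vf : 'cV[R]_n -> R).
Hypothesis f_cont : {within [set p | U p.2], continuous (fun p => f p.1 p.2)}.
Hypothesis l_cont : {within [set p | U p.2], continuous (fun p => l p.1 p.2)}.
Hypothesis U_compact : compact U.
Hypotheses (X_closed : closed X) (Xf_closed : closed Xf).
Hypothesis Vf_cont : continuous Vf.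
Hypothesis XN_compact : compact (feasible_states f U X Xf N).

Lemma trajS (us : N.-tuple 'cV[R]_m) k x : (k < N)%N ->
  traj f us k.+1 x = f (traj f us k x) (nth 0 us k).
Proof.
by move=> kN; rewrite /traj (take_nth 0) ?size_tuple // -cats1 foldl_cat.
Qed.

(** Input sequences as row vectors of column vectors, for the sake of the product
    topology on these. *)
Definition row_inputs (v : 'rV['cV[R]_m]_N) : N.-tuple 'cV[R]_m :=
  [tuple v ord0 i | i < N].

Lemma row_inputsK (us : N.-tuple 'cV[R]_m) :
  row_inputs (\row_i tnth us i) = us.
Proof. by apply: eq_from_tnth => i; rewrite tnth_mktuple mxE. Qed.

Let D := [set p : 'cV[R]_n * 'rV['cV[R]_m]_N | forall i, U (p.2 ord0 i)].

Lemma input_continuous (i : 'I_N) :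
  {within D, continuous (fun p => tnth (row_inputs p.2) i)}.
Proof.
apply: continuous_subspaceT => p.
under eq_fun do rewrite tnth_mktuple.
apply: (@continuous_comp _ _ _ snd (fun v : 'rV['cV[R]_m]_N => v ord0 i)).
  exact: cvg_snd.
exact: rV_coord_continuous.
Qed.

Lemma traj_continuous k : (k <= N)%N ->
  {within D, continuous (fun p => traj f (row_inputs p.2) k p.1)}.
Proof.
elim: k => [_|k IH kN].
  apply: continuous_subspaceT => p; rewrite /traj.
  under eq_fun do rewrite take0 /=.
  exact: cvg_fst.
under eq_fun do
  rewrite trajS // -[k in nth _ _ k]/(nat_of_ord (Ordinal kN)) -tnth_nth.
apply: (@within_continuous_comp _ _ _ _ [set p | U p.2]
  (fun p : 'cV[R]_n * 'rV['cV[R]_m]_N =>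
     (traj f (row_inputs p.2) k p.1, tnth (row_inputs p.2) (Ordinal kN)))
  _ _ _ f_cont).
  apply: within_continuous_pair; last exact: input_continuous.
  exact: IH (ltnW kN).
by move=> p Dp /=; rewrite tnth_mktuple.
Qed.

Lemma cost_continuous :
  {within D, continuous (fun p => cost f l Vf p.1 (row_inputs p.2))}.
Proof.
move=> p; apply: continuousD.
  move: p; apply: continuous_big => [|k _]; first exact: add_continuous.
  apply: (@within_continuous_comp _ _ _ _ [set p | U p.2]
    (fun p : 'cV[R]_n * 'rV['cV[R]_m]_N =>
      (traj f (row_inputs p.2) k p.1, tnth (row_inputs p.2) k)) _ _ _ l_cont).
    apply: within_continuous_pair; last exact: input_continuous.
    exact/traj_continuous/ltnW.
  by move=> p Dp /=; rewrite tnth_mktuple.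
move: p; apply: (@within_continuous_comp _ _ _ _ setT) => //.
  exact: traj_continuous.
exact: continuous_subspaceT.
Qed.

Let F := [set p : 'cV[R]_n * 'rV['cV[R]_m]_N |
  feasible f U X Xf p.1 (row_inputs p.2)].

Lemma feasible_inputs : F `<=` D.
Proof. by move=> p [+ _ _] i => /(_ i); rewrite tnth_mktuple. Qed.

(** Feasible pairs lie in the product of the compact sets of feasible states and
    of input sequences, and form a closed set because the constraint sets are
    closed and trajectories are continuous in the initial state and the inputs,
    as long as the latter stay in [U]. *)
Lemma feasible_compact : compact F.
Proof.
have inputs_compact :
    compact [set v : 'rV['cV[R]_m]_N | forall i, U (v ord0 i)].
  exact: (@rV_compact _ _ (fun=> U) (fun=> U_compact)).
apply: subclosed_compact (compact_setX XN_compact inputs_compact) _; last first.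
  move=> p Fp; split; last exact: feasible_inputs.
  by exists (row_inputs p.2).
have U_closed : closed U.
  by apply: compact_closed U_compact; exact: norm_hausdorff.
move=> p Fp.
have FF : ProperFilter (within F (nbhs p)) by exact: within_nbhs_proper.
have inF (P : set _) : F `<=` P -> \forall q \near within F (nbhs p), P q.
  by move=> FP; apply: (@nearW _ (nbhs p)).
have Dp : D p.
  move=> i; pose coord (q : 'cV[R]_n * 'rV['cV[R]_m]_N) := q.2 ord0 i.
  apply: (@closed_cvg _ _ (within F (nbhs p)) _ coord U U_closed).
    by apply: inF => q /feasible_inputs Dq; exact: Dq.
  apply: cvg_within_filter.
  apply: (@continuous_comp _ _ _ snd (fun v : 'rV['cV[R]_m]_N => v ord0 i)).
    exact: cvg_snd.
  exact: rV_coord_continuous.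
have traj_cvg k : (k <= N)%N -> traj f (row_inputs q.2) k q.1
    @[q --> within F (nbhs p)] --> traj f (row_inputs p.2) k p.1.
  move=> kN W Wp.
  have /subspace_continuousP/(_ p Dp W Wp) := traj_continuous k kN.
  by apply: (@filterS _ (nbhs p)) => q /= + Fq; apply; exact: feasible_inputs.
split.
- by move=> i; rewrite tnth_mktuple.
- move=> k kN; apply: (closed_cvg X X_closed _ _ (traj_cvg k (ltnW kN))).
  by apply: inF => q [_ + _]; exact.
- apply: (closed_cvg Xf Xf_closed _ _ (traj_cvg N (leqnn N))).
  by apply: inF => q [].
Qed.

(** Common form of the nominal problem ([C] a singleton, [g] zero) and of the
    relaxed one ([C] the whole space, [g] the penalty). *)
Lemma feasible_argmin (C : set 'cV[R]_n) (g : 'cV[R]_n -> R) x0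
    (us0 : N.-tuple 'cV[R]_m) :
  closed C -> continuous g -> C x0 -> feasible f U X Xf x0 us0 ->
  exists p : 'cV[R]_n * N.-tuple 'cV[R]_m,
    [/\ C p.1, feasible f U X Xf p.1 p.2 &
      forall y (vs : N.-tuple 'cV[R]_m), C y -> feasible f U X Xf y vs ->
        cost f l Vf p.1 p.2 + g p.1 <= cost f l Vf y vs + g y].
Proof.
move=> C_closed g_cont Cx0 feas0.
have FC_compact : compact (F `&` fst @^-1` C).
  apply: compact_closedI; first exact: feasible_compact.
  by apply: preimage_closed => // p _; exact: cvg_fst.
have [] := @compact_EVT_min _ R
  (fun p => cost f l Vf p.1 (row_inputs p.2) + g p.1) _ _ FC_compact.
- by exists (x0, \row_i tnth us0 i); split=> //; rewrite /F /= row_inputsK.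
- apply: (@continuous_subspaceW _ _ _ D); first by move=> p [/feasible_inputs].
  have g_fst : {within D, continuous (fun p => g p.1)}.
    apply: continuous_subspaceT => p.
    by apply: (@continuous_comp _ _ _ fst g); [exact: cvg_fst | exact: g_cont].
  by move=> p; exact: continuousD (cost_continuous p) (g_fst p).
move=> p; rewrite inE => -[Fp Cp] pmin.
exists (p.1, row_inputs p.2); split=> //= y vs Cy feas.
have := pmin (y, \row_i tnth vs i); rewrite /= row_inputsK; apply.
by rewrite inE; split=> //; rewrite /F /= row_inputsK.
Qed.

Lemma V_nom_attained x0 : feasible_states f U X Xf N x0 ->
  exists2 us : N.-tuple 'cV[R]_m, feasible f U X Xf x0 us &
    V_nom f l U X Xf Vf N x0 = cost f l Vf x0 us.
Proof.
case=> us0 feas0.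
have x0_closed : closed [set x0].
  by apply: compact_closed (@compact_set1 _ x0); exact: norm_hausdorff.
have [[y us] /= [-> feas_us min_us]] := feasible_argmin [set x0] (fun=> 0) x0
  us0 x0_closed (@cst_continuous _ _ _) erefl feas0.
have [] : [set cost f l Vf x0 us | us in
    [set us : N.-tuple 'cV[R]_m | feasible f U X Xf x0 us]]
    (V_nom f l U X Xf Vf N x0).
  apply: minimum_mem; exists (cost f l Vf x0 us); split; first by exists us.
  move=> _ [vs feas_vs <-].
  by have := min_us x0 vs erefl feas_vs; rewrite !addr0.
by move=> vs feas_vs <-; exists vs.
Qed.

Lemma slack_minimizers_neq0 (Vd : 'cV[R]_n -> 'cV[R]_n -> R) lambda x :
  continuous (fun p : 'cV[R]_n * 'cV[R]_n => Vd p.1 p.2) ->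
  feasible_states f U X Xf N !=set0 ->
  slack_minimizers (N := N) f l U X Xf Vf Vd lambda x !=set0.
Proof.
move=> Vd_cont [x0 [us0 feas0]].
have penalty_cont : continuous (fun z => lambda * Vd x z).
  move=> z; apply: continuousM; first exact: cst_continuous.
  apply: (@continuous_comp _ _ _ (fun z => (x, z))
    (fun p : 'cV[R]_n * 'cV[R]_n => Vd p.1 p.2)); last exact: Vd_cont.
  exact: (@cvg_pair _ _ _ (nbhs z) (nbhs x) (nbhs z) _ _ _ _ _
    (cvg_cst x) cvg_id).
have [p [_ feasp minp]] := feasible_argmin setT _ x0 us0 closedT penalty_cont
  I feas0.
by exists p; split=> // q feasq; exact: minp.
Qed.

End Minimizers.

(** * The shifted candidate and the decrease of the value function *)

Section Shift.
Context {R : realType} {n m N : nat}.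
Variables (f : 'cV[R]_n -> 'cV[R]_m -> 'cV[R]_n).
Variables (l : 'cV[R]_n -> 'cV[R]_m -> R).
Variables (U : set 'cV[R]_m) (X Xf : set 'cV[R]_n).
Variables (Vf : 'cV[R]_n -> R).
Implicit Types (us : N.+1.-tuple 'cV[R]_m) (v : 'cV[R]_m) (x : 'cV[R]_n).

Definition shift us v : N.+1.-tuple 'cV[R]_m := [tuple of rcons (behead us) v].

Lemma tnth_head us : tnth us ord0 = head 0 us.
Proof. by rewrite (tnth_nth 0) nth0. Qed.

Lemma traj_shift us v x k : (k <= N)%N ->
  traj f (shift us v) k (f x (head 0 us)) = traj f us k.+1 x.
Proof.
by case/tupleP: us => u0 s kN; rewrite /traj /= -cats1 takel_cat ?size_tuple.
Qed.

Lemma nth_shift us v k : (k < N)%N -> nth 0 (shift us v) k = nth 0 us k.+1.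
Proof.
by case/tupleP: us => u0 s kN; rewrite /= nth_rcons size_tuple kN.
Qed.

Lemma nth_shift_last us v : nth 0 (shift us v) N = v.
Proof.
by case/tupleP: us => u0 s; rewrite /= nth_rcons size_tuple ltnn eqxx.
Qed.

Lemma traj_shift_last us v x :
  traj f (shift us v) N.+1 (f x (head 0 us)) = f (traj f us N.+1 x) v.
Proof. by rewrite trajS // traj_shift // nth_shift_last. Qed.

(** The last input comes from the terminal controller, which keeps the state in
    [Xf]; the old final state is now subject to [X], hence [Xf] within [X]. *)
Lemma feasible_shift us v x : Xf `<=` X -> U v ->
  Xf (f (traj f us N.+1 x) v) -> feasible f U X Xf x us ->
  feasible f U X Xf (f x (head 0 us)) (shift us v).
Proof.
move=> XfX Uv Xfv [Uus Xus Xfus]; split; last by rewrite traj_shift_last.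
- move=> i; rewrite (tnth_nth 0); have := ltn_ord i.
  rewrite ltnS leq_eqVlt => /predU1P[->|iN]; first by rewrite nth_shift_last.
  by have := Uus (lift ord0 (Ordinal iN)); rewrite nth_shift // (tnth_nth 0).
- move=> k; rewrite ltnS => kN; rewrite traj_shift //.
  by move: kN; rewrite leq_eqVlt => /predU1P[->|kN]; [exact: XfX | exact: Xus].
Qed.

(** The two costs share the stages [1, ..., N] of the original trajectory. *)
Lemma cost_shift us v x :
  cost f l Vf (f x (head 0 us)) (shift us v) + l x (head 0 us)
    + Vf (traj f us N.+1 x) =
  cost f l Vf x us + l (traj f us N.+1 x) v + Vf (f (traj f us N.+1 x) v).
Proof.
rewrite /cost big_ord_recr [in RHS]big_ord_recl /= traj_shift_last.
rewrite traj_shift // !(tnth_nth 0) /= nth_shift_last nth0.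
rewrite [X in X + _ + _ + _ + _](_ : _ =
  \sum_(i < N) l (traj f us i.+1 x) (nth 0 us i.+1)); last first.
  apply: eq_bigr => i _.
  by rewrite (tnth_nth 0) /= traj_shift 1?ltnW // nth_shift.
rewrite [X in _ = _ + X + _ + _ + _](_ : _ =
  \sum_(i < N) l (traj f us i.+1 x) (nth 0 us i.+1)); last first.
  by apply: eq_bigr => i _; rewrite (tnth_nth 0).
have -> : traj f us 0 x = x by rewrite /traj take0.
ring.
Qed.

Lemma cost_decrease us v x :
  Vf (f (traj f us N.+1 x) v)
    <= Vf (traj f us N.+1 x) - l (traj f us N.+1 x) v ->
  cost f l Vf (f x (head 0 us)) (shift us v)
    <= cost f l Vf x us - l x (head 0 us).
Proof. by have := cost_shift us v x; lra. Qed.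

(** The disturbance moves the measured state only. It enters through the penalty,
    where open-loop stability is an inequality between two trajectories driven
    by the same input [us_0]. *)
Lemma slack_cost_decrease (Vd : 'cV[R]_n -> 'cV[R]_n -> R) (lambda c3 c4 : R)
    us v x z w :
  0 < lambda ->
  Vf (f (traj f us N.+1 z) v)
    <= Vf (traj f us N.+1 z) - l (traj f us N.+1 z) v ->
  Vd (f x (head 0 us) + w) (f z (head 0 us)) - Vd x z
    <= - (c3 * enorm (x - z) ^+ 2) + c4 * enorm w ^+ 2 ->
  slack_cost f l Vf Vd lambda (f x (head 0 us) + w)
      (f z (head 0 us), shift us v)
    <= slack_cost f l Vf Vd lambda x (z, us)
       - (l z (head 0 us) + lambda * c3 * enorm (x - z) ^+ 2)
       + lambda * c4 * enorm w ^+ 2.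
Proof.
move=> lambda0 /cost_decrease cost_dec Vd_dec.
rewrite -(ler_pM2l lambda0) in Vd_dec.
by move: cost_dec Vd_dec; rewrite /slack_cost /=; lra.
Qed.

End Shift.

Lemma quadratic_Kinfty_gt0 (R : realType) (a : R -> R) c :
  class_Kinfty a -> (forall r, 0 <= r -> a r = c * r ^+ 2) -> 0 < c.
Proof.
case=> _ incr _ a0 ac; have := incr 0 1 (lexx _) ltr01.
by rewrite a0 ac // expr1n mulr1.
Qed.

(** * The closed-loop bound *)

Theorem theorem3 (R : realType) (n m N : nat) (hn : (0 < n)%N) (hN : (0 < N)%N)
  (f : 'cV[R]_n -> 'cV[R]_m -> 'cV[R]_n)
  (l : 'cV[R]_n -> 'cV[R]_m -> R)
  (U : set 'cV[R]_m) (X Xf : set 'cV[R]_n)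
  (Vf : 'cV[R]_n -> R) (Vd : 'cV[R]_n -> 'cV[R]_n -> R)
  (* setting *)
  (l_ge0 : forall x u, U u -> 0 <= l x u)
  (X_closed : closed X)
  (Vf_ge0 : forall x, 0 <= Vf x) (Vf_cont : continuous Vf)
  (Xf_sub : Xf `<=` X) (Xf_closed : closed Xf)
  (* conditions (R), (T), (S) *)
  (hR : regular f l U X)
  (hT : terminal f l U X Xf Vf N)
  (a1 a2 a3 a4 : R -> R)
  (hS : open_loop_stable f U Vd a1 a2 a3 a4)
  (* condition (E) *)
  (Q : 'M[R]_n) (Ru : 'M[R]_m) (hQ : posdef Q) (hRu : posdef Ru)
  (hl : forall x u, U u -> l x u = wnorm Q x ^+ 2 + wnorm Ru u ^+ 2)
  (c1 c2 c3 c4 : R)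
  (ha : forall r : R, 0 <= r ->
    [/\ a1 r = c1 * r ^+ 2, a2 r = c2 * r ^+ 2,
        a3 r = c3 * r ^+ 2 & a4 r = c4 * r ^+ 2])
  (lambda : R) (hlambda : 0 < lambda)
  (* an arbitrary selection of minimizers of the relaxed problem *)
  (argmin_slack : 'cV[R]_n -> 'cV[R]_n * N.-tuple 'cV[R]_m)
  (hargmin : forall x,
    slack_minimizers (N := N) f l U X Xf Vf Vd lambda x !=set0 ->
    slack_minimizers (N := N) f l U X Xf Vf Vd lambda x (argmin_slack x))
  (x0 : 'cV[R]_n) (hx0 : feasible_states f U X Xf N x0)
  (w x : nat -> 'cV[R]_n) (u : nat -> 'cV[R]_m)
  (x_init : x 0%N = x0)
  (u_def : forall k, u k = head 0 (argmin_slack (x k)).2)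
  (x_step : forall k, x k.+1 = f (x k) (u k) + w k)
  (T : nat) :
  let eps := lambda^-1 * (sigma_max Q / c3) in
  0 < eps /\
  (1 + eps)^-1 * \sum_(k < T) l (x k) (u k)
    <= V_nom f l U X Xf Vf N x0
       + lambda * c4 * \sum_(k < T) enorm (w k) ^+ 2.
Proof.
case: N hN hT argmin_slack hargmin hx0 u_def => [//|{}N] _ hT.
move=> argmin_slack hargmin hx0 u_def eps.
have [_ [[_ _ U0 _] [f_cont l_cont U_compact]]] := hR.
have [[kf [af [_ kfP]]] [_ XN_compact]] := hT.
have [Vd_ge0 [Vd_cont [[_ _ K3 _] VdP]]] := hS.
have {}U0 : U 0 by exact: nbhs_singleton U0.
have c3_gt0 : 0 < c3.
  by apply: (quadratic_Kinfty_gt0 R a3 c3 K3) => r r0; have [] := ha r r0.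
have sigma_gt0 := sigma_max_gt0 Q hn hQ.
have eps_gt0 : 0 < eps by rewrite mulr_gt0 ?divr_gt0 ?invr_gt0.
split=> //.
have one_eps : 0 < 1 + eps by rewrite addr_gt0.
have lQ y v : U v -> l y v = qform Q y + qform Ru v.
  by move=> Uv; rewrite hl // !wnorm_sqr.
have argminP y :
    slack_minimizers (N := N.+1) f l U X Xf Vf Vd lambda y (argmin_slack y).
  by apply/hargmin/slack_minimizers_neq0 => //; exists x0.
have [us1 feas1 V_nomE] := V_nom_attained f l U X Xf Vf f_cont l_cont U_compact
  X_closed Xf_closed Vf_cont XN_compact x0 hx0.
pose V y := slack_cost f l Vf Vd lambda y (argmin_slack y).
have V_ge0 y : 0 <= V y.
  have [[Up _ _] _] := argminP y.
  rewrite addr_ge0 ?mulr_ge0 ?(ltW hlambda) //.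
  by rewrite addr_ge0 // sumr_ge0 // => k _; exact: l_ge0.
have V_x0 : V x0 <= V_nom f l U X Xf Vf N.+1 x0.
  have [_ /(_ (x0, us1) feas1) /le_trans] := argminP x0; apply.
  have [/andP[_]] := VdP x0 x0 0 0 U0.
  have [_ -> _ _] := ha _ (enorm_ge0 (x0 - x0)).
  (* The candidate z = x0 pays no penalty, as the upper bound on Vd vanishes on
     the diagonal; 0 serves as an arbitrary element of U. *)
  rewrite subrr enorm0 expr0n mulr0 /slack_cost V_nomE /= => Vd_le0 _.
  by rewrite gerDl pmulr_rle0.
have decrease k : (1 + eps)^-1 * l (x k) (u k) <=
    V (x k) - V (x k.+1) + lambda * c4 * enorm (w k) ^+ 2.
  have [[Up Xp Xfp] _] := argminP (x k).
  have [_ min_next] := argminP (x k.+1).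
  move: (u_def k) (x_step k) Up Xp Xfp.
  rewrite /V [slack_cost _ _ _ _ _ (x k) _]/slack_cost.
  case: (argmin_slack (x k)) => z us /= -> x_next Uus Xus Xfus.
  set xN := traj f us N.+1 z in Xfus.
  have [Vf_dec [_ Ukf] Xf_inv _] := kfP xN Xfus.
  have Uu : U (head 0 us) by rewrite -tnth_head.
  have feas_next : feasible f U X Xf (f z (head 0 us)) (shift us (kf xN)).
    exact: feasible_shift.
  have opt_next := min_next (f z (head 0 us), shift us (kf xN)) feas_next.
  have [_ Vd_next] := VdP (x k) z (w k) (head 0 us) Uu.
  have [_ _ a3E _] := ha _ (enorm_ge0 (x k - z)).
  have [_ _ _ a4E] := ha _ (enorm_ge0 (w k)).
  rewrite a3E a4E in Vd_next.
  have := slack_cost_decrease f l Vf Vd lambda c3 c4 us (kf xN) (x k) z (w k)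
    hlambda Vf_dec Vd_next.
  rewrite -x_next => cand_next.
  have young := stage_cost_young R n m Q Ru eps (x k) z (head 0 us)
    hn hQ hRu eps_gt0.
  have slope : sigma_max Q / eps = lambda * c3.
    by rewrite /eps; field; rewrite !gt_eqF.
  rewrite slope in young; rewrite (lQ (x k)) // ler_pdivrMl //.
  apply: le_trans young _; rewrite ler_pM2l // -(lQ z) //.
  by move: opt_next cand_next; rewrite /slack_cost /=; lra.
have telescope : (1 + eps)^-1 * \sum_(k < T) l (x k) (u k) <=
    V (x 0%N) - V (x T) + lambda * c4 * \sum_(k < T) enorm (w k) ^+ 2.
  elim: T => [|t IH]; first by rewrite !big_ord0 !mulr0 subrr addr0.
  rewrite !big_ord_recr /= !mulrDr; move: IH (decrease t); lra.
by move: telescope V_x0 (V_ge0 (x T)); rewrite x_init; lra.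
Qed.
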